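(* Let $G$ be a finite, simple, undirected graph with $n$ vertices, average degree $d$, and degree deviation $s$ with $s>0$. Let $\lambda(G)$ be the spectral radius of $G$ and let $\tilde{\lambda}(G)$ be the largest eigenvalue of the smoothed adjacency matrix $\tilde{A}$ of $G$. If either $s>\frac{dn}{\sqrt{2}}$, or $s\leq \frac{dn}{\sqrt{2}}$ and $d\leq \frac{n}{2}$, then $$\lambda(G)-d\geq\tilde{\lambda}(G)-d\geq \frac{s^2}{n^2\sqrt{2dn}}.$$
   Context: Let $G$ have vertex set $V$, $n$ vertices, $m$ edges and average degree $d=\frac{2m}{n}$. The degree deviation is $s=s(G)=\sum_{u\in V}|d_G(u)-d|$. The spectral radius $\lambda(G)$ is the largest eigenvalue of the adjacency matrix of $G$. Smoothed adjacency matrix: Let $V_+=\{u\in V: d_G(u)>d\}$, $V_-=\{u\in V: d_G(u)\leq d\}$, $n_+=|V_+|$, $n_-=|V_-|$. Let $m_+$ and $m_-$ be the numbers of edges of the induced subgraphs $G[V_+]$ and $G[V_-]$, respectively, and let $m_{\pm}=m-(m_++m_-)$. Let $w_+=m_+/\binom{n_+}{2}$, $w_-=m_-/\binom{n_-}{2}$, $w_{\pm}=m_{\pm}/(n_+n_-)$, where a quotient with denominator $0$ is set to $0$. The matrix $\tilde{A}=(\tilde{a}_{u,v})_{u,v\in V}$ is the symmetric matrix with $\tilde{a}_{u,v}=w_+$ if $u,v\in V_+$ and $u\neq v$; $\tilde{a}_{u,v}=w_-$ if $u,v\in V_-$ and $u\neq v$; $\tilde{a}_{u,v}=w_{\pm}$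 if exactly one of $u,v$ lies in $V_+$; and $\tilde{a}_{u,u}=0$. Then $\tilde{\lambda}(G)$ is the largest eigenvalue of $\tilde{A}$. *)

(* Defs.v *)
From HB Require Import structures.
From mathcomp Require Import all_boot all_order all_algebra.
From mathcomp Require Import boolp classical_sets reals.
From mathcomp Require complex polyrcf.

Set Implicit Arguments.
Unset Strict Implicit.
Unset Printing Implicit Defensive.

Import Order.TTheory GRing.Theory Num.Theory.
Local Open Scope ring_scope.

(* A finite simple undirected graph is a finType T together with a symmetric
   and irreflexive adjacency relation e : rel T. *)

Definition degree (T : finType) (e : rel T) (u : T) : nat :=
  #|[set v | e u v]|.

Definition edges (T : finType) (e : rel T) : {set {set T}} :=
  [set [set u; v] | u in T, v in T & e u v].

(* The edges of the subgraph induced on U. *)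
Definition edges_in (T : finType) (e : rel T) (U : {set T}) : {set {set T}} :=
  [set E in edges e | E \subset U].

Definition avg_degree (R : realType) (T : finType) (e : rel T) : R :=
  2 * #|edges e|%:R / #|T|%:R.

Definition degree_deviation (R : realType) (T : finType) (e : rel T) : R :=
  \sum_(u : T) `| (degree e u)%:R - avg_degree R e |.

Definition Vplus (R : realType) (T : finType) (e : rel T) : {set T} :=
  [set u | (degree e u)%:R > avg_degree R e].

Definition Vminus (R : realType) (T : finType) (e : rel T) : {set T} :=
  [set u | (degree e u)%:R <= avg_degree R e].

(* In a field x / 0 = 0, so the densities below vanish when their denominator
   does. *)
Definition density_in (R : realType) (T : finType) (e : rel T)
    (U : {set T}) : R :=
  #|edges_in e U|%:R / 'C(#|U|, 2)%:R.

Definition density_across (R : realType) (T : finType) (e : rel T) : R :=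
  (#|edges e|%:R
     - (#|edges_in e (Vplus R e)|%:R + #|edges_in e (Vminus R e)|%:R))
  / (#|Vplus R e|%:R * #|Vminus R e|%:R).

(* Matrices indexed by T are transported to ordinals along enum_val. *)
Definition mx_of_fun (R : realType) (T : finType) (f : T -> T -> R) :
    'M[R]_#|T| :=
  \matrix_(i < #|T|, j < #|T|) f (enum_val i) (enum_val j).

Definition adj_mx (R : realType) (T : finType) (e : rel T) : 'M[R]_#|T| :=
  mx_of_fun (fun u v => (e u v)%:R).

Definition smoothed_adj (R : realType) (T : finType) (e : rel T)
    (u v : T) : R :=
  if u == v then 0
  else if (u \in Vplus R e) && (v \in Vplus R e) then
    density_in R e (Vplus R e)
  else if (u \in Vminus R e) && (v \in Vminus R e) then
    density_in R e (Vminus R e)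
  else density_across R e.

Definition smoothed_adj_mx (R : realType) (T : finType) (e : rel T) :
    'M[R]_#|T| :=
  mx_of_fun (smoothed_adj R e).

Definition is_largest_eigenvalue (R : realType) (n : nat) (A : 'M[R]_n)
    (a : R) : Prop :=
  eigenvalue A a /\ forall b : R, eigenvalue A b -> b <= a.

(* The default value 0 is only used for matrices without any real eigenvalue;
   see largest_eigenvalueP for the symmetric case. *)
Definition largest_eigenvalue (R : realType) (n : nat) (A : 'M[R]_n) : R :=
  xget 0 [set a | is_largest_eigenvalue A a]%classic.

Definition spectral_radius (R : realType) (T : finType) (e : rel T) : R :=
  largest_eigenvalue (adj_mx R e).

Definition smoothed_spectral_radius (R : realType) (T : finType)
    (e : rel T) : R :=
  largest_eigenvalue (smoothed_adj_mx R e).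

Import complex.

Lemma symmetric_eigenvalue_exists (R : rcfType) (n : nat) (A : 'M[R]_n) :
  (0 < n)%N -> A^T = A -> exists a, eigenvalue A a.
Proof.
move=> n_gt0 symA.
pose toC := @complex.real_complex R.
have [a] := spectral.eigenvalue_closed (map_mx toC A) n_gt0.
move=> aP; have /eigenvalueP[v vA v0] := aP.
pose vc := map_mx Num.conj v.
have cA : map_mx Num.conj (map_mx toC A) = map_mx toC A.
  apply/matrixP => i j; rewrite !mxE; apply/conj_Creal.
  by rewrite complex.complex_real.
have eq1 : v *m map_mx toC A *m vc^T = a *: (v *m vc^T).
  by rewrite vA -scalemxAl.
have eq2 : v *m map_mx toC A *m vc^T = a^* *: (v *m vc^T).
  have -> : v *m map_mx toC A *m vc^T = v *m (vc *m map_mx toC A)^T.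
    by rewrite trmx_mul (map_trmx toC A) symA mulmxA.
  have -> : vc *m map_mx toC A = a^* *: vc.
    by rewrite -{1}cA -map_mxM vA map_mxZ.
  by rewrite linearZ /= -scalemxAr.
have nz : (v *m vc^T) 0 0 != 0.
  rewrite mxE; apply: contra v0 => /eqP s0; apply/eqP/rowP => j.
  have := s0; under eq_bigr do rewrite !mxE -normCK.
  move/eqP; rewrite psumr_eq0 => [|i _]; last exact: exprn_ge0.
  by move/allP/(_ j (mem_index_enum _)); rewrite expf_eq0 normr_eq0 mxE => /eqP.
have areal : a \is Num.real.
  apply/CrealP; move: eq2; rewrite eq1 => /(congr1 (fun M : 'M_1 => M 0 0)).
  by rewrite [LHS]mxE [RHS]mxE => /(mulIf nz).
exists (complex.Re a); rewrite eigenvalue_root_char.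
rewrite eigenvalue_root_char -(complex.RRe_real areal) in aP.
by rewrite -(fmorph_root toC) map_char_poly.
Qed.

Lemma largest_eigenvalueP (R : realType) (n : nat) (A : 'M[R]_n) :
  (0 < n)%N -> A^T = A -> is_largest_eigenvalue A (largest_eigenvalue A).
Proof.
move=> n_gt0 symA; rewrite /largest_eigenvalue.
apply: (@xgetPex _ 0 [set a | is_largest_eigenvalue A a]%classic).
have [a aP] := symmetric_eigenvalue_exists n_gt0 symA.
have p0 : char_poly A != 0 by rewrite -size_poly_eq0 size_char_poly.
pose s := polyrcf.rootsR (char_poly A).
have inS b : (b \in s) = eigenvalue A b.
  by rewrite eigenvalue_root_char -(polyrcf.roots_on_rootsR p0) in_itv.
have aS : a \in s by rewrite inS.
exists (\big[Num.max/a]_(b <- s) b); split=> /=.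
  by rewrite -inS big_seq; elim/big_ind: _ => // x y; case: (leP x y).
by move=> b; rewrite -inS => bs; exact: (le_bigmax_seq a b xpredT id bs).
Qed.

(* Main.v *)
(* A vector equal to a on V_+ and to b on V_- has the same quadratic form for
   the adjacency matrix A and for its smoothed version, namely
     x (A - d) x^T = t (a^2 - b^2) - c (a - b)^2,   t = s / 2,
   where c counts the edges between V_+ and V_-. Maximizing the Rayleigh
   quotient over such vectors is a 2x2 problem, and it yields at least
   d + beta, beta = s^2 / (n^2 sqrt (2 d n)), as soon as
     p q beta^2 + beta (c n + t (p - q)) <= t^2,   p = #|V_+|, q = #|V_-|.
   Nonnegativity of m_+ and m_- gives c <= d p + t and c <= d q - t, which
   together bound c n + t (p - q) by (d^2 n^2 - s^2) / (2 d) when s <= d n.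
   Two vertices of V_+ (or of V_-) are twins for the smoothed matrix, so an
   eigenvector with a positive eigenvalue takes equal values on them. Hence the
   top eigenvector of the smoothed matrix is constant on V_+ and on V_-, and
   serves as a test vector for A. *)
Require Import Defs.
From mathcomp Require Import all_boot all_order all_algebra.
From mathcomp Require Import reals.
From mathcomp Require Import complex ring lra.
Import Order.TTheory GRing.Theory Num.Theory.
Local Open Scope ring_scope.

(** * Rayleigh bound for real symmetric matrices *)

Section Rayleigh.
Local Open Scope sesquilinear_scope.

(** Over the complexification the matrix is hermitian, hence unitarily diagonalizable. In
    coordinates [y] for the eigenbasis the form is a sum of [|y_i|^2] weighted by real
    eigenvalues. *)
Lemma rayleigh_le (R : rcfType) (n : nat) (A : 'M[R]_n) (a : R)
    (x : 'rV[R]_n) :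
  A^T = A -> (forall b, eigenvalue A b -> b <= a) ->
  (x *m A *m x^T) 0 0 <= a * (x *m x^T) 0 0.
Proof.
move=> symA aP.
pose toC := @real_complex R.
set B := map_mx toC A.
have conj_toC m p (M : 'M[R]_(m, p)) :
    map_mx Num.conj (map_mx toC M) = map_mx toC M.
  by apply/matrixP => i j; rewrite !mxE; apply/conj_Creal; rewrite complex_real.
have hermB : B \is hermsymmx.
  by apply/is_hermitianmxP; rewrite expr0 scale1r map_trmx conj_toC symA.
have /orthomx_spectralP B_eq := hermitian_normalmx hermB.
have Dreal := hermitian_spectral_diag_real hermB.
have Punit := spectral_unit B.
have Punitary := spectral_unitarymx B.
move: (spectralmx B) (spectral_diag B) B_eq Dreal Punit Punitary.
move=> P D B_eq Dreal Punit Punitary.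
have D_le i : D 0 i <= toC a.
  have Di : D 0 i \is Num.real by have /mxOverP := Dreal; apply.
  rewrite -(RRe_real Di) lecR; apply: aP.
  (* [aP] concerns eigenvalues over [R], so [D 0 i] descends as a root of the characteristic
     polynomial; row [i] of [P] is its complex eigenvector. *)
  rewrite eigenvalue_root_char -(fmorph_root toC) map_char_poly.
  rewrite -eigenvalue_root_char [X in eigenvalue _ X](RRe_real Di).
  apply/eigenvalueP; exists (row i P).
    rewrite -row_mul -/B B_eq !mulmxA mulmxV // mul1mx row_mul.
    by rewrite row_diag_mx -scalemxAl -rowE.
  apply/eqP => Pi0; have := congr1 (row i) (mulmxV Punit).
  rewrite row_mul Pi0 mul0mx => /rowP/(_ i)/eqP.
  by rewrite !mxE eqxx eq_sym oner_eq0.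
pose y := map_mx toC x *m P^t*.
have xA : toC ((x *m A *m x^T) 0 0) = \sum_i D 0 i * `|y 0 i| ^+ 2.
  have -> : toC ((x *m A *m x^T) 0 0) = (y *m diag_mx D *m y^t*) 0 0.
    have -> : y *m diag_mx D *m y^t* = map_mx toC (x *m A *m x^T).
      rewrite /y trmx_mul map_mxM trmxCK !map_mxM -/B B_eq invmx_unitary //.
     by rewrite map_trmx conj_toC !mulmxA.
    by rewrite [RHS]mxE.
  rewrite mxE; apply: eq_bigr => i _.
  by rewrite mul_mx_diag !mxE normCK mulrAC mulrC mulrA.
have xx : toC ((x *m x^T) 0 0) = \sum_i `|y 0 i| ^+ 2.
  have -> : toC ((x *m x^T) 0 0) = (y *m y^t*) 0 0.
    have -> : y *m y^t* = map_mx toC (x *m x^T).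
      rewrite /y trmx_mul map_mxM trmxCK !map_mxM mulmxA mulmxKtV //.
      by rewrite map_trmx conj_toC.
    by rewrite [RHS]mxE.
  by rewrite mxE; apply: eq_bigr => i _; rewrite !mxE normCK.
suff : toC ((x *m A *m x^T) 0 0) <= toC (a * (x *m x^T) 0 0) by rewrite lecR.
have -> b c : toC (b * c) = toC b * toC c by exact: (rmorphM (real_complex R)).
rewrite xA xx mulr_sumr ler_sum // => i _.
by rewrite ler_wpM2r // exprn_ge0.
Qed.
End Rayleigh.

(** * The 2x2 quotient problem *)

(* The left side minus the right side is the determinant of the quadratic form
   x (A - (d + b)) x^T on vectors constant on both parts. *)
Lemma quotient_det_le0 (R : rcfType) (p q d t c b : R) :
  0 < p -> 0 < q -> 0 < t -> c <= d * q - t -> c <= d * p + t ->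
  t <= d * q -> t + d * p <= (p + q) * p ->
  d * (p + q) / Num.sqrt 2 < 2 * t \/ d <= (p + q) / 2 ->
  b = (2 * t) ^+ 2 / ((p + q) ^+ 2 * Num.sqrt (2 * d * (p + q))) ->
  p * q * b ^+ 2 + b * (c * (p + q) + t * (p - q)) <= t ^+ 2.
Proof.
move=> p0 q0 t0 cq cp tq tp cond.
have d0 : 0 < d by rewrite -(pmulr_lgt0 _ q0); exact: lt_le_trans tq.
have n0 : 0 < p + q by rewrite addr_gt0.
have K1 : c * (p + q) + t * (p - q) <= q * (d * (p + q) - 2 * t).
  by have := ler_wpM2r (ltW n0) cq; lra.
have K2 : c * (p + q) + t * (p - q) <= p * (d * (p + q) + 2 * t).
  by have := ler_wpM2r (ltW n0) cp; lra.
have dn : d <= p + q by rewrite -(ler_pM2r p0); lra.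
have cond' : (d * (p + q)) ^+ 2 <= 8 * t ^+ 2 \/ d <= (p + q) / 2.
  case: cond => [h|]; [left|by right].
  have s0 : 0 < Num.sqrt 2 :> R by rewrite sqrtr_gt0.
  move: h; rewrite ltr_pdivrMr // => /ltW h.
  have -> : 8 * t ^+ 2 = (2 * t * Num.sqrt 2) ^+ 2.
    by rewrite exprMn sqr_sqrtr ?ler0n //; ring.
  by rewrite ler_pXn2r // nnegrE ?mulr_ge0 // ltW // mulr_gt0.
move: (c * (p + q) + t * (p - q)) K1 K2 => K K1 K2 ->.
have pq4 : 4 * (p * q) <= (p + q) ^+ 2.
  by have := sqr_ge0 (p - q); rewrite !expr2; lra.
have : 0 < Num.sqrt (2 * d * (p + q)) by rewrite sqrtr_gt0 !mulr_gt0.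
have := @sqr_sqrtr R (2 * d * (p + q)) ltac:(by rewrite ltW // !mulr_gt0).
move: (Num.sqrt (2 * d * (p + q))) => r rr r0.
set n := p + q in n0 K1 K2 dn pq4 rr cond' *.
(* [r] is the square root in [b]; all denominators are cleared. *)
suff main : 16 * (p * q) * t ^+ 2 + 4 * K * n ^+ 2 * r <= n ^+ 4 * r ^+ 2.
  have -> : p * q * ((2 * t) ^+ 2 / (n ^+ 2 * r)) ^+ 2 +
      (2 * t) ^+ 2 / (n ^+ 2 * r) * K =
      t ^+ 2 * ((16 * (p * q) * t ^+ 2 + 4 * K * n ^+ 2 * r)
                / (n ^+ 4 * r ^+ 2)).
    by field; rewrite !gt_eqF.
  rewrite ler_piMr ?sqr_ge0 // ler_pdivrMr ?mul1r //.
  by rewrite mulr_gt0 // exprn_gt0.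
have dr : d <= r.
  rewrite -(@ler_pXn2r _ 2) ?nnegrE ?(ltW d0) ?(ltW r0) // rr expr2 mulrAC.
  by rewrite ler_pM2r //; lra.
(* When [2 * t > d * n], [K1] makes [K] nonpositive and only the [p * q] term remains. *)
have [small|large] := leP (2 * t) (d * n); last first.
  have Kn : 4 * K * n ^+ 2 * r <= 0.
    rewrite -!mulrA pmulr_rle0 // pmulr_lle0 ?mulr_gt0 ?exprn_gt0 //.
    by rewrite (le_trans K1) // pmulr_rle0 //; lra.
  apply: le_trans (_ : 16 * (p * q) * t ^+ 2 <= _); first by lra.
  have tp' : t <= n * p by apply: le_trans tp; rewrite lerDl mulr_ge0 // ltW.
  (* Multiplying the two bounds on [t] produces [(4 p q)^2], at most [n^4] by [pq4]. *)
  have tt : t ^+ 2 <= d * q * (n * p) by rewrite expr2 ler_pM // ltW.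
  have := ler_wpM2l (_ : 0 <= 16 * (p * q)) tt.
  move=> /(_ ltac:(by rewrite !mulr_ge0 // ltW)) /le_trans; apply.
  have pq0 : 0 <= 4 * (p * q) by rewrite !mulr_ge0 // ltW.
  have := ler_wpM2l (ltW (mulr_gt0 d0 n0)) (ler_pM pq0 pq0 pq4 pq4).
  have : 0 <= d * n * n ^+ 4 by rewrite !mulr_ge0 ?exprn_ge0 // ltW.
  by rewrite rr; lra.
have KL : 2 * d * K <= (d * n) ^+ 2 - 4 * t ^+ 2.
  (* Average [K1] and [K2] with weights making their right sides proportional. *)
  rewrite -(ler_pM2l n0).
  have a1 := ler_wpM2l (_ : 0 <= d * n + 2 * t) K1.
  have a2 := ler_wpM2l (_ : 0 <= d * n - 2 * t) K2.
  have := lerD (a1 ltac:(by rewrite addr_ge0 ?mulr_ge0 // ltW)) (a2 ltac:(lra)).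
  rewrite -/n (_ : n = p + q) //; lra.
(* This is [main] times [d], with [p q] replaced by [n^2 / 4] and [2 d K] by its bound [KL], then
   divided by [2 n^2]. *)
suff main2 : 2 * t ^+ 2 * d + ((d * n) ^+ 2 - 4 * t ^+ 2) * r <= d ^+ 2 * n ^+ 3.
  rewrite -(ler_pM2l d0) rr.
  have := ler_wpM2l (_ : 0 <= 2 * n ^+ 2 * r) KL.
  move=> /(_ ltac:(by rewrite !mulr_ge0 ?exprn_ge0 // ltW)).
  have := ler_wpM2l (_ : 0 <= 2 * n ^+ 2) main2.
  move=> /(_ ltac:(by rewrite !mulr_ge0 ?exprn_ge0 // ltW)).
  have := ler_wpM2l (_ : 0 <= 4 * d * t ^+ 2) pq4.
  move=> /(_ ltac:(by rewrite !mulr_ge0 ?exprn_ge0 // ltW)).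
  by lra.
have dnn : 0 <= (d * n) ^+ 2 by rewrite sqr_ge0.
case: cond' => [tt|d2].
  (* Here [8 t^2 >= (d n)^2] bounds the left side of the goal by [(d n)^2 (r / 2 + d / 4)]. Since
     [d <= n], the rational bound [3 / 2] on [r / n] suffices: [3 / 4 + 1 / 4 = 1]. *)
  have rn : r <= 3 / 2 * n.
    rewrite -(@ler_pXn2r _ 2) ?nnegrE ?(ltW r0) //; last by lra.
    rewrite rr.
    have := ler_wpM2r (ltW n0) dn; have := sqr_ge0 n; rewrite expr2 exprMn !expr2; lra.
  have := ler_wpM2r (_ : 0 <= 2 * r - d) tt => /(_ ltac:(lra)).
  have := ler_wpM2l dnn rn; have := ler_wpM2l dnn dn.
  by lra.
(* Now [r^2 = 2 d n <= n^2], and the terms in [t^2] sum to a nonpositive number because [d <= r]. *)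
have rn : r <= n.
  rewrite -(@ler_pXn2r _ 2) ?nnegrE ?(ltW n0) ?(ltW r0) // rr.
  by have := ler_wpM2r (ltW n0) d2; rewrite expr2; lra.
have := ler_wpM2l dnn rn; have := ler_wpM2l (sqr_ge0 t) dr.
have : 0 <= t ^+ 2 * r by rewrite mulr_ge0 ?sqr_ge0 // ltW.
by lra.
Qed.

(** The vector [(g, c)] is chosen to annihilate the second row [(c, - t - c - b q)] of the 2x2 form.
    The form then equals [g] times the first row's value, which is minus the determinant. *)
Lemma quotient_test_vector (R : realFieldType) (p q d t c b : R) :
  0 < p -> 0 <= q -> 0 < t -> 0 <= c -> 0 <= b ->
  p * q * b ^+ 2 + b * (c * (p + q) + t * (p - q)) <= t ^+ 2 ->
  let g := t + c + b * q in
  0 < p * g ^+ 2 + q * c ^+ 2 /\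
  (d + b) * (p * g ^+ 2 + q * c ^+ 2) <=
  g ^+ 2 * (d * p + t - c) + c ^+ 2 * (d * q - t - c) + 2 * (g * c * c).
Proof.
move=> p0 q0 t0 c0 b0 h g.
have g0 : 0 < g by rewrite /g -addrA ltr_wpDr // addr_ge0 // mulr_ge0.
split; first by rewrite ltr_wpDr ?mulr_ge0 ?sqr_ge0 // mulr_gt0 // exprn_gt0.
rewrite -subr_ge0 (_ : _ - _ =
  g * (t ^+ 2 - (p * q * b ^+ 2 + b * (c * (p + q) + t * (p - q))))).
  by rewrite mulr_ge0 ?subr_ge0 // ltW.
by rewrite /g; ring.
Qed.

(** * Counting edges by ordered pairs *)

Lemma mem_edges_in (T : finType) (e : rel T) (U : {set T}) (E : {set T}) :
  reflect (exists u v, [/\ u \in U, v \in U, e u v & E = [set u; v]])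
    (E \in edges_in e U).
Proof.
rewrite inE; apply: (iffP andP) => [[/imset2P[u v _ + ->]]|].
  by rewrite inE /= => uv; rewrite subUset !sub1set => /andP[uU vU]; exists u, v.
move=> [u [v [uU vU uv ->]]]; split; last by rewrite subUset !sub1set uU.
by apply/imset2P; exists u v; rewrite ?inE.
Qed.

(** Each edge is the image under [ends] of exactly two ordered pairs, distinct by irreflexivity. *)
Lemma double_card_edges_in (T : finType) (e : rel T) (U : {set T}) :
  symmetric e -> irreflexive e ->
  (\sum_(u in U) \sum_(v in U) e u v = 2 * #|edges_in e U|)%N.
Proof.
move=> e_sym e_irr.
pose P := [set p : T * T | [&& p.1 \in U, p.2 \in U & e p.1 p.2]].
pose ends (p : T * T) := [set p.1; p.2].
have -> : (\sum_(u in U) \sum_(v in U) e u v = #|P|)%N.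
  rewrite pair_big /= -sum1_card big_mkcond [RHS]big_mkcond /=.
  apply: eq_bigr => -[u v] _; rewrite inE /=.
  by case: (u \in U); case: (v \in U); case: (e u v).
rewrite -sum1_card (partition_big ends [in edges_in e U]) /=; last first.
  by move=> [u v]; rewrite inE => /and3P[uU vU uv]; apply/mem_edges_in; exists u, v.
rewrite mulnC -sum_nat_const; apply: eq_bigr => E /mem_edges_in[u [v]].
move=> [uU vU uv ->]; have uNv : u != v by apply: contraTneq uv => ->; rewrite e_irr.
rewrite sum1dep_card (_ : [set _ | _] = [set (u, v); (v, u)]).
  by rewrite cards2 xpair_eqE (negPf uNv).
apply/setP => -[a b]; rewrite !inE !xpair_eqE /=; apply/idP/idP; last first.
  by case/orP => /andP[/eqP-> /eqP->]; rewrite ?uU ?vU ?uv ?eqxx //= e_sym uv setUC eqxx.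
case/andP => /and3P[_ _ ab] /eqP abuv; rewrite /ends /= in abuv.
have aNb : a != b by apply: contraTneq ab => ->; rewrite e_irr.
have : a \in [set u; v] by rewrite -abuv !inE eqxx.
have : b \in [set u; v] by rewrite -abuv !inE eqxx orbT.
by rewrite !inE => /orP[]/eqP bE /orP[]/eqP aE; move: aNb; rewrite aE bE !eqxx ?orbT.
Qed.

(** * Quadratic forms and eigenvectors indexed by vertices *)

Lemma tr_mx_of_fun (R : realType) (T : finType) (f : T -> T -> R) :
  (forall u v, f u v = f v u) -> (mx_of_fun f)^T = mx_of_fun f.
Proof. by move=> fC; apply/matrixP => i j; rewrite !mxE fC. Qed.

Lemma quad_form_le_largest (R : realType) (T : finType) (f : T -> T -> R)
    (x : T -> R) :
  (0 < #|T|)%N -> (forall u v, f u v = f v u) ->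
  \sum_u \sum_v x u * f u v * x v <=
  largest_eigenvalue (mx_of_fun f) * \sum_u x u ^+ 2.
Proof.
move=> T0 fC; have trf := tr_mx_of_fun _ _ _ fC.
have [_ maxf] := largest_eigenvalueP T0 trf.
have := rayleigh_le _ _ _ _ (\row_i x (enum_val i)) trf maxf.
have enumR (F : T -> R) : \sum_u F u = \sum_(i < #|T|) F (enum_val i).
  by rewrite (reindex (@enum_val T T)) //; exact/onW_bij/enum_val_bij.
congr (_ <= _ * _).
  rewrite exchange_big enumR mxE; apply: eq_bigr => j _.
  by rewrite enumR !mxE mulr_suml; apply: eq_bigr => i _; rewrite !mxE.
by rewrite enumR mxE; apply: eq_bigr => i _; rewrite !mxE expr2.
Qed.

Lemma largest_eigenvectorP (R : realType) (T : finType) (f : T -> T -> R) :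
  (0 < #|T|)%N -> (forall u v, f u v = f v u) ->
  exists2 x : T -> R, exists u, x u != 0 &
    forall v, \sum_u x u * f u v = largest_eigenvalue (mx_of_fun f) * x v.
Proof.
move=> T0 fC; have trf := tr_mx_of_fun _ _ _ fC.
have [/eigenvalueP[x xf x0] _] := largest_eigenvalueP T0 trf.
exists (fun u => x 0 (enum_rank u)).
  have /rV0Pn[i xi] := x0.
  by exists (enum_val i); rewrite enum_valK.
move=> v; move/rowP/(_ (enum_rank v)): xf; rewrite !mxE => <-.
rewrite (reindex (@enum_val T T)); last exact/onW_bij/enum_val_bij.
by apply: eq_bigr => i _; rewrite mxE enum_rankK enum_valK.
Qed.

Lemma sum_setID (V : nmodType) (T : finType) (A : {set T}) (F : T -> V) :
  \sum_u F u = \sum_(u in A) F u + \sum_(u in ~: A) F u.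
Proof.
by rewrite (bigID (mem A)) /=; congr (_ + _); apply: eq_bigl => u; rewrite inE.
Qed.

(** On such vectors the form depends only on the block sums of [f], which is why smoothing cannot
    change it. *)
Lemma two_valued_quad_form (R : comNzRingType) (T : finType) (f : T -> T -> R)
    (A : {set T}) (a b : R) (x : T -> R) :
  (forall u v, f u v = f v u) -> (forall u, x u = if u \in A then a else b) ->
  \sum_u \sum_v x u * f u v * x v =
  a ^+ 2 * (\sum_(u in A) \sum_(v in A) f u v)
  + b ^+ 2 * (\sum_(u in ~: A) \sum_(v in ~: A) f u v)
  + 2 * (a * b * (\sum_(u in A) \sum_(v in ~: A) f u v)).
Proof.
move=> fC xE.
have block (B C : {set T}) (k l : R) :
    {in B, forall u, x u = k} -> {in C, forall u, x u = l} ->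
    \sum_(u in B) \sum_(v in C) x u * f u v * x v =
    k * l * \sum_(u in B) \sum_(v in C) f u v.
  move=> xB xC; rewrite mulr_sumr; apply: eq_bigr => u uB.
  rewrite mulr_sumr; apply: eq_bigr => v vC.
  by rewrite xB // xC //; ring.
have xA : {in A, forall u, x u = a} by move=> u uA; rewrite xE uA.
have xAC : {in ~: A, forall u, x u = b}.
  by move=> u; rewrite inE xE => /negPf->.
rewrite (sum_setID _ _ A); under eq_bigr do rewrite (sum_setID _ _ A).
under [X in _ + X]eq_bigr do rewrite (sum_setID _ _ A).
rewrite !big_split /= (block _ _ a a) // (block _ _ a b) // (block _ _ b a) //.
rewrite (block _ _ b b) // [X in b * a * X]exchange_big /=.
under [X in b * a * X]eq_bigr do under eq_bigr do rewrite fC.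
by ring.
Qed.

(** * Block sums of adjacencies and densities *)

Lemma sum_adj_in (R : realType) (T : finType) (e : rel T) (U : {set T}) :
  symmetric e -> irreflexive e ->
  \sum_(u in U) \sum_(v in U) (e u v)%:R = 2 * #|edges_in e U|%:R :> R.
Proof.
move=> e_sym e_irr; rewrite -natrM -double_card_edges_in // natr_sum.
by apply: eq_bigr => u _; rewrite natr_sum.
Qed.

Lemma edges_inT (T : finType) (e : rel T) : edges_in e [set: T] = edges e.
Proof. by apply/setP => E; rewrite inE subsetT andbT. Qed.

Lemma sum_adj (R : realType) (T : finType) (e : rel T) :
  symmetric e -> irreflexive e ->
  \sum_u \sum_v (e u v)%:R = 2 * #|edges e|%:R :> R.
Proof.
move=> e_sym e_irr; rewrite -edges_inT -sum_adj_in //.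
apply: eq_big => [u|u _]; first by rewrite inE.
by apply: eq_bigl => v; rewrite inE.
Qed.

Lemma sum_off_diagonal (T : finType) (U : {set T}) :
  (\sum_(u in U) \sum_(v in U) (u != v) = 2 * 'C(#|U|, 2))%N.
Proof.
rewrite -mul_bin_diag bin1 -sum_nat_const; apply: eq_bigr => u uU.
rewrite [in RHS](cardsD1 u) uU add1n /= -sum1_card big_mkcond [RHS]big_mkcond /=.
apply: eq_bigr => v _; rewrite !inE eq_sym.
by case: (v \in U); case: (v == u).
Qed.

Lemma card_edges_in_le (T : finType) (e : rel T) (U : {set T}) :
  symmetric e -> irreflexive e -> (#|edges_in e U| <= 'C(#|U|, 2))%N.
Proof.
move=> e_sym e_irr; rewrite -(leq_pmul2l (ltn0Sn 1)) -double_card_edges_in //.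
rewrite -sum_off_diagonal; do 2 apply: leq_sum => ? _.
by case: eqVneq => [->|]; rewrite ?e_irr ?leq_b1.
Qed.

Lemma sum_density_in (R : realType) (T : finType) (e : rel T) (U : {set T}) :
  symmetric e -> irreflexive e ->
  \sum_(u in U) \sum_(v in U) (u != v)%:R * density_in R e U
  = 2 * #|edges_in e U|%:R.
Proof.
move=> e_sym e_irr; under eq_bigr do rewrite -mulr_suml -natr_sum.
rewrite -mulr_suml -natr_sum sum_off_diagonal natrM /density_in.
(* With a zero denominator the density is 0 by convention, consistently with the absence of
   edges. *)
case: (posnP 'C(#|U|, 2)) => [U0|U0].
  have := card_edges_in_le _ _ U e_sym e_irr.
  by rewrite U0 leqn0 => /eqP->; rewrite mul0r !mulr0.
by rewrite -mulrA [X in _ * X]mulrC divfK // pnatr_eq0 -lt0n.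
Qed.

Lemma Vminus_setC (R : realType) (T : finType) (e : rel T) :
  Vminus R e = ~: Vplus R e.
Proof. by apply/setP => u; rewrite !inE leNgt. Qed.

Lemma sum_adj_across (R : realType) (T : finType) (e : rel T) (U : {set T}) :
  symmetric e -> irreflexive e ->
  \sum_(u in U) \sum_(v in ~: U) (e u v)%:R =
  #|edges e|%:R - (#|edges_in e U|%:R + #|edges_in e (~: U)|%:R) :> R.
Proof.
move=> e_sym e_irr.
have eC u v : (e u v)%:R = (e v u)%:R :> R by rewrite e_sym.
(* The constant vector 1 splits twice the number of edges into block sums, to be solved for the
   cross term. *)
have := two_valued_quad_form _ _ _ U 1 1 (fun=> 1) eC (fun u => esym (if_same _ _)).
under eq_bigr do under eq_bigr do rewrite mul1r mulr1.
by rewrite sum_adj // !sum_adj_in //; lra.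
Qed.

(** * Comparison of the two spectral radii *)

(** Subtracting the eigenvector equations at [u] and [v] cancels every other vertex and leaves
    [(l + f u v) (x u - x v) = 0], with a positive first factor. *)
Lemma twins_eigenvector_eq (R : realFieldType) (T : finType) (f : T -> T -> R)
    (x : T -> R) (l : R) (u v : T) :
  (forall w, \sum_u x u * f u w = l * x w) -> 0 < l ->
  f u u = 0 -> f v v = 0 -> f v u = f u v -> 0 <= f u v ->
  (forall w, w != u -> w != v -> f w u = f w v) -> x u = x v.
Proof.
move=> xf l0 fu fv fC fuv ftwin; have [-> //|uNv] := eqVneq u v.
have /eqP : (l + f u v) * (x u - x v) = 0.
  have : \sum_w x w * (f w u - f w v) = l * x u - l * x v.
    by rewrite -!xf -sumrB; apply: eq_bigr => w _; rewrite mulrBr.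
  rewrite (bigD1 u) // (bigD1 v) 1?eq_sym //= big1 => [|w /andP[wu wv]].
    by rewrite fu fv fC; lra.
  by rewrite ftwin // subrr mulr0.
by rewrite mulf_eq0 gt_eqF ?ltr_wpDr //= subr_eq0 => /eqP.
Qed.

Lemma smoothed_adjC (R : realType) (T : finType) (e : rel T) (u v : T) :
  smoothed_adj R e u v = smoothed_adj R e v u.
Proof.
by rewrite /smoothed_adj eq_sym [(u \in Vplus R e) && _]andbC
  [(u \in Vminus R e) && _]andbC.
Qed.

Lemma density_in_ge0 (R : realType) (T : finType) (e : rel T) (U : {set T}) :
  0 <= density_in R e U.
Proof. by rewrite divr_ge0. Qed.

(** Averaging within each block preserves its sum, so [two_valued_quad_form] gives equal values. *)
Lemma smoothed_quad_form (R : realType) (T : finType) (e : rel T) (a b : R)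
    (x : T -> R) :
  symmetric e -> irreflexive e ->
  (forall u, x u = if u \in Vplus R e then a else b) ->
  \sum_u \sum_v x u * smoothed_adj R e u v * x v =
  \sum_u \sum_v x u * (e u v)%:R * x v.
Proof.
move=> e_sym e_irr xE.
rewrite (two_valued_quad_form _ _ _ _ _ _ _ (smoothed_adjC R T e) xE).
have eC u v : (e u v)%:R = (e v u)%:R :> R by rewrite e_sym.
rewrite (two_valued_quad_form _ _ _ _ _ _ _ eC xE) !sum_adj_in // sum_adj_across //.
rewrite -!sum_density_in //.
congr (_ * _ + _ * _ + _ * (_ * _)).
- apply: eq_bigr => u uP; apply: eq_bigr => v vP.
  rewrite /smoothed_adj uP vP /=.
  by case: eqP => _; rewrite ?mul0r ?mul1r.
- apply: eq_bigr => u; rewrite in_setC => uP; apply: eq_bigr => v; rewrite in_setC => vP.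
  rewrite /smoothed_adj (negPf uP) Vminus_setC !in_setC uP vP /=.
  by case: eqP => _; rewrite ?mul0r ?mul1r.
transitivity (\sum_(u in Vplus R e) \sum_(v in ~: Vplus R e) density_across R e).
  apply: eq_bigr => u uP; apply: eq_bigr => v; rewrite in_setC => vP.
  rewrite /smoothed_adj uP (negPf vP) Vminus_setC !in_setC uP vP /=.
  by case: eqVneq vP => // <-; rewrite uP.
rewrite !sumr_const -mulrnA -[LHS]mulr_natl mulnC natrM /density_across Vminus_setC.
rewrite -sum_adj_across //.
(* If the denominator of the cross density is 0, one part is empty and the cross sum vanishes
   too. *)
have [z|nz] := eqVneq ((#|Vplus R e| * #|~: Vplus R e|)%N%:R : R) 0; last first.
  by rewrite -!natrM [LHS]mulrC divfK.
rewrite -!natrM z mul0r; apply/esym/eqP.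
move: z => /eqP; rewrite pnatr_eq0 muln_eq0 !cards_eq0 => /orP[] /eqP ->.
  by rewrite big_set0.
by rewrite big1 // => u _; rewrite big_set0.
Qed.

Lemma spectral_radius_ge_smoothed (R : realType) (T : finType) (e : rel T) :
  (0 < #|T|)%N -> symmetric e -> irreflexive e ->
  0 < smoothed_spectral_radius R e ->
  smoothed_spectral_radius R e <= spectral_radius R e.
Proof.
move=> T0 e_sym e_irr l0.
have [x [u0 xu0] xf] := largest_eigenvectorP _ _ _ T0 (smoothed_adjC R T e).
have cP u v : u \in Vplus R e -> v \in Vplus R e -> x u = x v.
  move=> uP vP; apply: (twins_eigenvector_eq _ _ _ _ _ _ _ xf l0).
  - by rewrite /smoothed_adj eqxx.
  - by rewrite /smoothed_adj eqxx.
  - exact: smoothed_adjC.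
  - by rewrite /smoothed_adj; case: eqP => // _; rewrite uP vP density_in_ge0.
  - move=> w /negPf wu /negPf wv.
    by rewrite /smoothed_adj wu wv uP vP !Vminus_setC !in_setC uP vP !andbF.
have cM u v : u \notin Vplus R e -> v \notin Vplus R e -> x u = x v.
  move=> uP vP; apply: (twins_eigenvector_eq _ _ _ _ _ _ _ xf l0).
  - by rewrite /smoothed_adj eqxx.
  - by rewrite /smoothed_adj eqxx.
  - exact: smoothed_adjC.
  - rewrite /smoothed_adj; case: eqP => // _; rewrite Vminus_setC !in_setC uP vP.
    by rewrite (negPf uP) density_in_ge0.
  - move=> w /negPf wu /negPf wv.
    by rewrite /smoothed_adj wu wv (negPf uP) (negPf vP) !Vminus_setC !in_setC uP vP !andbF.
(* The default 0 is taken only when the part is empty. *)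
pose a := if [pick u in Vplus R e] is Some u then x u else 0.
pose b := if [pick u | u \notin Vplus R e] is Some u then x u else 0.
have xE u : x u = if u \in Vplus R e then a else b.
  rewrite /a /b; case: ifPn => uP.
    by case: pickP => [v vP|/(_ u)]; [exact: cP | rewrite uP].
  by case: pickP => [v vP|/(_ u)]; [exact: cM | rewrite uP].
have xx : 0 < \sum_u x u ^+ 2.
  rewrite (bigD1 u0) //= ltr_pwDl ?exprn_even_gt0 //.
  by apply: sumr_ge0 => u _; rewrite sqr_ge0.
have eC u v : (e u v)%:R = (e v u)%:R :> R by rewrite e_sym.
(* The eigenvector [x] of the smoothed matrix is now a test vector for the adjacency matrix, with
   the same quadratic form. *)
rewrite -(ler_pM2r xx); apply: le_trans (quad_form_le_largest _ _ _ x T0 eC).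
rewrite -(smoothed_quad_form _ _ _ _ _ _ e_sym e_irr xE) exchange_big mulr_sumr.
by apply: ler_sum => v _; rewrite -mulr_suml xf expr2 mulrA.
Qed.

(** * Average degree and degree deviation *)

Lemma degreeE (R : realType) (T : finType) (e : rel T) (u : T) :
  (degree e u)%:R = \sum_v (e u v)%:R :> R.
Proof.
rewrite /degree -sum1_card natr_sum big_mkcond; apply: eq_bigr => v _.
by rewrite inE; case: (e u v).
Qed.

Lemma avg_degree_card (R : realType) (T : finType) (e : rel T) :
  (0 < #|T|)%N -> avg_degree R e * #|T|%:R = 2 * #|edges e|%:R.
Proof. by move=> T0; rewrite divfK // pnatr_eq0 -lt0n. Qed.

Lemma sum_degree_dev (R : realType) (T : finType) (e : rel T) :
  (0 < #|T|)%N -> symmetric e -> irreflexive e ->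
  \sum_u ((degree e u)%:R - avg_degree R e) = 0.
Proof.
move=> T0 e_sym e_irr; rewrite sumrB sumr_const -[_ *+ _]mulr_natr avg_degree_card //.
by under eq_bigr do rewrite degreeE; rewrite sum_adj // subrr.
Qed.

(** Signed deviations sum to 0, so the excess on [Vplus] and the deficit on its complement
    balance. *)
Lemma degree_deviation_halves (R : realType) (T : finType) (e : rel T) :
  (0 < #|T|)%N -> symmetric e -> irreflexive e ->
  \sum_(u in Vplus R e) ((degree e u)%:R - avg_degree R e)
    = degree_deviation R e / 2 /\
  \sum_(u in ~: Vplus R e) (avg_degree R e - (degree e u)%:R)
    = degree_deviation R e / 2.
Proof.
move=> T0 e_sym e_irr; have := sum_degree_dev R T e T0 e_sym e_irr.
rewrite /degree_deviation !(sum_setID _ _ (Vplus R e)).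
have -> : \sum_(u in ~: Vplus R e) ((degree e u)%:R - avg_degree R e) =
    - \sum_(u in ~: Vplus R e) (avg_degree R e - (degree e u)%:R).
  by rewrite -sumrN; apply: eq_bigr => u _; rewrite opprB.
rewrite [X in _ -> _ = (X + _) / 2 /\ _ = (X + _) / 2](eq_bigr
  (fun u => (degree e u)%:R - avg_degree R e)); last first.
  by move=> u; rewrite inE => uP; rewrite ger0_norm // subr_ge0 ltW.
rewrite [X in _ -> _ = (_ + X) / 2 /\ _ = (_ + X) / 2](eq_bigr
  (fun u => avg_degree R e - (degree e u)%:R)); last first.
  move=> u; rewrite in_setC inE -leNgt => uP.
  by rewrite ler0_norm ?opprB // subr_le0.
by lra.
Qed.

Lemma degree_deviation_gt0_card (R : realType) (T : finType) (e : rel T) :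
  0 < degree_deviation R e -> (0 < #|T|)%N.
Proof.
rewrite lt0n; apply: contraTneq => /card0_eq T0.
by rewrite /degree_deviation big_pred0 ?ltxx // => u; have := T0 u.
Qed.

(** Otherwise no vertex could have a positive deficit, yet the deficits outside [Vplus] sum to
    [s / 2 > 0]. *)
Lemma avg_degree_gt0 (R : realType) (T : finType) (e : rel T) :
  symmetric e -> irreflexive e -> 0 < degree_deviation R e ->
  0 < avg_degree R e.
Proof.
move=> e_sym e_irr s0; have T0 := degree_deviation_gt0_card _ _ _ s0.
have [_ tM] := degree_deviation_halves R T e T0 e_sym e_irr.
rewrite ltNge; apply/negP => d0; have : degree_deviation R e / 2 <= 0; last by lra.
by rewrite -tM sumr_le0 // => u _; rewrite subr_le0 (le_trans d0).
Qed.

(** * Lower bound for the smoothed spectral radius *)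

Lemma smoothed_spectral_radius_ge (R : realType) (T : finType) (e : rel T) :
  let n : R := #|T|%:R in
  let d : R := avg_degree R e in
  let s : R := degree_deviation R e in
  symmetric e -> irreflexive e ->
  0 < s ->
  d * n / Num.sqrt 2 < s \/ d <= n / 2 ->
  d + s ^+ 2 / (n ^+ 2 * Num.sqrt (2 * d * n)) <= smoothed_spectral_radius R e.
Proof.
move=> n d s e_sym e_irr s0 cond.
have T0 := degree_deviation_gt0_card _ _ _ s0.
have [tP tM] := degree_deviation_halves R T e T0 e_sym e_irr.
rewrite -/d -/s in tP tM.
set A := Vplus R e in tP tM.
pose p : R := #|A|%:R; pose q : R := #|~: A|%:R.
pose c : R := \sum_(u in A) \sum_(v in ~: A) (e u v)%:R.
pose MP : R := \sum_(u in A) \sum_(v in A) (e u v)%:R.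
pose MM : R := \sum_(u in ~: A) \sum_(v in ~: A) (e u v)%:R.
have nE : n = p + q by rewrite -natrD cardsC.
have eC u v : (e u v)%:R = (e v u)%:R :> R by rewrite e_sym.
(* The degrees in [A] sum to [d p + s / 2], and also to [MP + c]; the complement is treated
   likewise. *)
have MPE : MP = d * p + s / 2 - c.
  rewrite -tP sumrB sumr_const -mulr_natr -/p.
  under eq_bigr do rewrite degreeE (sum_setID _ _ A).
  by rewrite big_split /= -/MP -/c; ring.
have MME : MM = d * q - s / 2 - c.
  rewrite -tM sumrB sumr_const -mulr_natr -/q.
  under [X in _ - (_ - X)]eq_bigr do rewrite degreeE (sum_setID _ _ A).
  rewrite big_split /= -/MM [X in X + MM]exchange_big /=.
  under [X in X + MM]eq_bigr do under eq_bigr do rewrite eC.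
  by rewrite -/c; ring.
have ge0 (B C : {set T}) : 0 <= \sum_(u in B) \sum_(v in C) (e u v)%:R :> R.
  by do 2 apply: sumr_ge0 => ? _.
have c0 : 0 <= c by exact: ge0.
have MP0 : 0 <= MP by exact: ge0.
have MM0 : 0 <= MM by exact: ge0.
have card_gt0 (B : {set T}) (F : T -> R) :
    \sum_(u in B) F u = s / 2 -> 0 < #|B|%:R :> R.
  rewrite ltr0n card_gt0; apply: contra_eqN => /eqP ->.
  by rewrite big_set0 eq_sym gt_eqF // divr_gt0.
have p0 : 0 < p := card_gt0 _ _ tP.
have q0 : 0 < q := card_gt0 _ _ tM.
have t0 : 0 < s / 2 by rewrite divr_gt0.
have s2 : 2 * (s / 2) = s by lra.
have tp : s / 2 + d * p <= (p + q) * p.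
  have -> : s / 2 + d * p = \sum_(u in A) (degree e u)%:R.
    by rewrite -tP sumrB sumr_const -mulr_natr -/p; ring.
  rewrite -nE [leRHS]mulrC /p mulr_natl -sumr_const; apply: ler_sum => u _.
  by rewrite ler_nat max_card.
pose b := s ^+ 2 / (n ^+ 2 * Num.sqrt (2 * d * n)).
have bE : b = (2 * (s / 2)) ^+ 2 / ((p + q) ^+ 2 * Num.sqrt (2 * d * (p + q))).
  by rewrite s2 -nE.
have b0 : 0 <= b by rewrite divr_ge0 ?sqr_ge0 // mulr_ge0 ?sqrtr_ge0 ?sqr_ge0.
have det : p * q * b ^+ 2 + b * (c * (p + q) + s / 2 * (p - q)) <= (s / 2) ^+ 2.
  (* The two upper bounds on [c] are [MP0] and [MM0] rewritten; adding [c0] to the latter gives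
     [t <= d q]. *)
  apply: (quotient_det_le0 _ _ _ d) => //; rewrite -?nE ?s2 //; lra.
have [X0 XQ] := quotient_test_vector _ _ _ d _ _ _ p0 (ltW q0) t0 c0 b0 det.
set g := s / 2 + c + b * q in X0 XQ.
pose x u := if u \in A then g else c.
have xx : \sum_u x u ^+ 2 = p * g ^+ 2 + q * c ^+ 2.
  rewrite (sum_setID _ _ A) /p /q !mulr_natl -!sumr_const; congr (_ + _).
    by apply: eq_bigr => u uA; rewrite /x uA.
  by apply: eq_bigr => u; rewrite in_setC /x => /negPf->.
have := quad_form_le_largest _ _ _ x T0 (smoothed_adjC R T e).
rewrite (smoothed_quad_form _ _ _ g c) // (two_valued_quad_form _ _ _ A g c _ eC) //.
rewrite -/MP -/MM -/c xx MPE MME => /(le_trans XQ).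
by rewrite ler_pM2r.
Qed.

Theorem corollary8 (R : realType) (T : finType) (e : rel T)
    (esym : symmetric e) (eirr : irreflexive e) :
  let n : R := #|T|%:R in
  let d : R := avg_degree R e in
  let s : R := degree_deviation R e in
  0 < s ->
  d * n / Num.sqrt 2 < s \/ (s <= d * n / Num.sqrt 2 /\ d <= n / 2) ->
  spectral_radius R e - d >= smoothed_spectral_radius R e - d /\
  smoothed_spectral_radius R e - d >= s ^+ 2 / (n ^+ 2 * Num.sqrt (2 * d * n)).
Proof.
move=> n d s s0 cond.
have bound := smoothed_spectral_radius_ge R T e esym eirr s0
  ltac:(by case: cond => [|[_]]; [left|right]).
split; last by rewrite lerBrDl.
rewrite lerD2r; apply: spectral_radius_ge_smoothed => //.
  exact: degree_deviation_gt0_card s0.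
(* The lower bound, together with [d > 0], supplies the positivity that the twin argument
   requires. *)
apply: lt_le_trans bound; rewrite ltr_pwDl ?avg_degree_gt0 //.
by rewrite divr_ge0 ?sqr_ge0 // mulr_ge0 ?sqrtr_ge0 ?sqr_ge0.
Qed.
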